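(* Let $\mathcal{H}$ be a real Hilbert space, let $A:\mathcal{H}\rightrightarrows\mathcal{H}$ be a maximally monotone operator and let $B:\mathcal{H}\rightarrow\mathcal{H}$ be a monotone and $\beta$-Lipschitzian operator for some $\beta>0$. Suppose that $\operatorname{zer}(A+B)\neq\emptyset$. Let $\lambda,\sigma>0$ and $\alpha_1,\alpha_2\geq 0$ be such that $$12\alpha_2^2+9(\alpha_1+\alpha_2)+4\sigma<1,$$ let $(\lambda_n)_{n\geq 1}$ be a sequence of real numbers such that $$\lambda\leq\lambda_n\leq\frac{1}{\beta}\sqrt{\frac{1-12\alpha_2^2-9(\alpha_1+\alpha_2)-4\sigma}{12\alpha_2^2+8(\alpha_1+\alpha_2)+4\sigma+2}}\quad\text{for all } n\geq 1,$$ and, for $i=1,2$, let $(\alpha_{i,n})_{n\geq 1}$ be a nondecreasing sequence with $\alpha_{i,1}=0$ and $0\leq\alpha_{i,n}\leq\alpha_i$ for all $n\geq 1$. Let $x_0,x_1\in\mathcal{H}$ be arbitrary and define, for all $n\geq 1$, $$\begin{aligned} p_n&=J_{\lambda_nA}\big[x_n-\lambda_nBx_n+\alpha_{1,n}(x_n-x_{n-1})\big],\\ x_{n+1}&=p_n+\lambda_n(Bx_n-Bp_n)+\alpha_{2,n}(x_n-x_{n-1}). \end{aligned}$$ Then there exists $\overline{x}\in\operatorname{zer}(A+B)$ such that the following statements are true: (a) $\sum_{n\in\mathbb{N}}\|x_{n+1}-x_n\|^2<+\infty$ and $\sum_{n\geq 1}\|x_n-p_n\|^2<+\infty$; (b)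 $x_n\rightharpoonup\overline{x}$ and $p_n\rightharpoonup\overline{x}$ (weakly) as $n\rightarrow+\infty$; (c) if one of the following conditions is satisfied: (i) $A+B$ is demiregular at $\overline{x}$; (ii) $A$ or $B$ is uniformly monotone at $\overline{x}$; then $x_n\rightarrow\overline{x}$ and $p_n\rightarrow\overline{x}$ (strongly) as $n\rightarrow+\infty$.
   Context: $\mathbb{N}=\{0,1,2,\dots\}$. The symbols $\rightharpoonup$ and $\rightarrow$ denote weak and strong convergence. For a set-valued operator $T:\mathcal{H}\rightrightarrows\mathcal{H}$: $\operatorname{Gr}T=\{(x,u):u\in Tx\}$ is its graph, $\operatorname{dom}T=\{x:Tx\neq\emptyset\}$ its domain, $\operatorname{zer}T=\{x\in\mathcal{H}:0\in Tx\}$ its set of zeros. $T$ is monotone if $\langle x-y,u-v\rangle\geq 0$ for all $(x,u),(y,v)\in\operatorname{Gr}T$, and maximally monotone if it is monotone and its graph has no proper monotone extension in $\mathcal{H}\times\mathcal{H}$. The resolvent of $T$ is $J_T=(\operatorname{Id}_{\mathcal{H}}+T)^{-1}$, which is single-valued and everywhere defined on $\mathcal{H}$ when $T$ is maximally monotone. A single-valued operator $B:\mathcal{H}\to\mathcal{H}$ is $\beta$-Lipschitzian if $\|Bx-By\|\leq\beta\|x-y\|$ for all $x,y\in\mathcal{H}$. $T$ is demiregular at $x\in\operatorname{dom}T$ if, for every sequence $(x_n,u_n)_{n\in\mathbb{N}}$ in $\operatorname{Gr}T$ and every $u\in Tx$ such that $x_n\rightharpoonup x$ and $u_n\rightarrow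 u$, one has $x_n\rightarrow x$. $T$ is uniformly monotone at $x\in\operatorname{dom}T$ if there exists an increasing function $\phi_T:[0,+\infty)\rightarrow[0,+\infty]$ that vanishes only at $0$ such that $\langle x-y,u-v\rangle\geq\phi_T(\|x-y\|)$ for every $u\in Tx$ and every $(y,v)\in\operatorname{Gr}T$. *)

(* Defs.v *)
From HB Require Import structures.
From mathcomp Require Import all_boot all_order all_algebra.
From mathcomp Require Import all_classical all_reals all_analysis.

Set Implicit Arguments.
Unset Strict Implicit.
Unset Printing Implicit Defensive.

Import Order.TTheory GRing.Theory Num.Theory.
Import numFieldNormedType.Exports.

Local Open Scope classical_set_scope.
Local Open Scope ring_scope.

(* With theta the identity, {dot H for theta} is the type of symmetric positive
   definite bilinear forms. *)
HB.mixin Record NormedModule_isHilbert (R : realType) H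
    of CompleteNormedModule R H := {
  inner : {dot H for (@idfun R)};
  sqr_norm_inner : forall x : H, `|x| ^+ 2 = inner x x }.

#[short(type="hilbertType")]
HB.structure Definition Hilbert (R : realType) :=
  {H of CompleteNormedModule R H & NormedModule_isHilbert R H}.

Section Operators.
Context {R : realType} {H : hilbertType R}.
Implicit Types (T S : H -> set H) (x y u v : H).

Definition graph_op T : set (H * H) := [set z | T z.1 z.2].

Definition dom_op T : set H := [set x | T x !=set0].

Definition zer_op T : set H := [set x | T x 0].

Definition op_of_fun (f : H -> H) : H -> set H := fun x => [set f x].

Definition op_inv T : H -> set H := fun u => [set x | T x u].

Definition op_add T S : H -> set H :=
  fun x => [set u + v | u in T x & v in S x].

Definition op_scale (c : R) T : H -> set H := fun x => [set c *: u | u in T x].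

Definition monotone_op T : Prop := forall x y u v,
  graph_op T (x, u) -> graph_op T (y, v) -> 0 <= inner (x - y) (u - v).

Definition maximally_monotone T : Prop :=
  monotone_op T /\
  forall S, monotone_op S ->
    graph_op T `<=` graph_op S -> graph_op S = graph_op T.

(* The value of (Id + T)^-1 at z. This set is a singleton when T is maximally
   monotone; the default 0 is only returned when it is empty. *)
Definition resolvent T (z : H) : H :=
  xget 0 (op_inv (op_add (op_of_fun idfun) T) z).

(* By the Riesz representation theorem, the continuous linear functionals on H
   are the maps inner ^~ y. *)
Definition weak_cvg (x_ : nat -> H) x : Prop :=
  forall y, inner (x_ n) y @[n --> \oo] --> inner x y.

Definition demiregular_at T x : Prop :=
  dom_op T x /\
  forall (x_ u_ : nat -> H) u,
    (forall n, graph_op T (x_ n, u_ n)) -> T x u ->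
    weak_cvg x_ x -> u_ @ \oo --> u -> x_ @ \oo --> x.

(* Only the values of phi on [0, +oo[ matter. As phi may take the value +oo on
   an unbounded interval, "increasing" is meant in the non-strict sense. *)
Definition uniformly_monotone_at T x : Prop :=
  dom_op T x /\
  exists phi : R -> \bar R,
    [/\ forall t, 0 <= t -> (0 <= phi t)%E,
        forall s t, 0 <= s -> s <= t -> (phi s <= phi t)%E,
        forall t, 0 <= t -> (phi t = 0%E <-> t = 0)
      & forall u y v, T x u -> graph_op T (y, v) ->
          (phi `|x - y|%R <= (inner (x - y)%R (u - v)%R)%:E)%E].

End Operators.

(* Main.v *)
Require Import Defs.
From mathcomp Require Import all_boot all_order all_algebra.
From mathcomp Require Import all_classical all_reals all_analysis.
From mathcomp Require Import ring lra.
Set Implicit Arguments.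
Unset Strict Implicit.
Unset Printing Implicit Defensive.

Import Order.TTheory GRing.Theory Num.Theory.
Import numFieldNormedType.Exports.
Local Open Scope classical_set_scope.
Local Open Scope ring_scope.

(* For z in zer (A + B), monotonicity of A and B between z and p_n gives
   <p_n - z, x_n - x_(n+1) + (alpha_(1,n) + alpha_(2,n)) (x_n - x_(n-1))> >= 0,
   hence a recursive inequality for |x_n - z|^2 in which the step-size bound makes
   |x_n - x_(n-1)|^2 and |x_n - p_n|^2 summable and |x_n - z|^2 convergent. Weak
   convergence follows as in Opial's lemma, with weak limits along ultrafilters
   in place of weakly convergent subsequences: such limits exist by the Riesz
   representation theorem, are unique, and are zeros of A + B by Minty's theorem.
   The theorems of Riesz and Minty both come from minimizing a quadratic
   function over a closed convex set. *)

(** * Inner products and minimization *)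

(* The type of [inner x y] is the carrier of a numDomainType built from R; the
   topology and the decision procedures need it to be R itself. *)
Definition ip (R : realType) (H : hilbertType R) (x y : H) : R := inner x y.

Section Inner.
Context {R : realType} {H : hilbertType R}.
Implicit Types (x y z : H) (a : R).

Lemma sqr_norm_ip x : `|x| ^+ 2 = ip x x.
Proof. exact: sqr_norm_inner. Qed.

Lemma ipC x y : ip x y = ip y x.
Proof. by rewrite /ip hermC expr0 mul1r. Qed.

Lemma ipDl x y z : ip (x + y) z = ip x z + ip y z.
Proof. exact: linearDl. Qed.

Lemma ipDr x y z : ip z (x + y) = ip z x + ip z y.
Proof. exact: linearDr. Qed.

Lemma ipZl a x z : ip (a *: x) z = a * ip x z.
Proof. exact: linearZl_LR. Qed.

Lemma ipZr a x z : ip z (a *: x) = a * ip z x.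
Proof. exact: linearZr_LR. Qed.

Lemma ipNl x z : ip (- x) z = - ip x z.
Proof. exact: linearNl. Qed.

Lemma ipNr x z : ip z (- x) = - ip z x.
Proof. exact: linearNr. Qed.

Lemma ip0l x : ip 0 x = 0.
Proof. exact: linear0l. Qed.

Lemma ip0r x : ip x 0 = 0.
Proof. exact: linear0r. Qed.

Definition ipE :=
  (ipDl, ipDr, ipZl, ipZr, ipNl, ipNr, ip0l, ip0r).

Lemma ip_ge0 x : 0 <= ip x x.
Proof. by rewrite -sqr_norm_ip sqr_ge0. Qed.

(** Cauchy-Schwarz: the squared norm of <y,y> x - <x,y> y equals <y,y> (<x,x> <y,y> - <x,y>^2). *)
Lemma normr_ip_le x y : `|ip x y| <= `|x| * `|y|.
Proof.
rewrite -ler_sqr ?nnegrE ?mulr_ge0// exprMn !sqr_norm_ip real_normK ?num_real//.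
have [y0|y0] := eqVneq (ip y y) 0.
  suff -> : y = 0 by rewrite !ip0r expr0n mulr0.
  by apply/eqP; rewrite -normr_eq0 -sqrf_eq0 sqr_norm_ip y0.
have yp : 0 < ip y y by rewrite lt_def y0 ip_ge0.
have := ip_ge0 (ip y y *: x - ip x y *: y).
rewrite !ipE (ipC y x).
set a := ip x x; set b := ip x y; set c := ip y y => h.
have : 0 <= c * (a * c - b ^+ 2) by lra.
by rewrite pmulr_rge0// subr_ge0.
Qed.

Lemma ip_le x y : ip x y <= `|x| * `|y|.
Proof. exact: le_trans (ler_norm _) (normr_ip_le _ _). Qed.

(* Turns identities between vectors into identities between reals. *)
Lemma ip_inj x y : (forall z, ip x z = ip y z) -> x = y.
Proof.
move=> h; apply/eqP; rewrite -subr_eq0 -normr_eq0 -sqrf_eq0 sqr_norm_ip.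
by rewrite ipDl ipNl h subrr.
Qed.

End Inner.

(** * Limits along general filters *)

Section Limits.
Context {R : realType} {V : normedModType R}.

Lemma cvg_dist_le T (F : set_system T) {FF : Filter F} (f : T -> V) (g : T -> R)
    l :
  (\forall t \near F, `|f t - l| <= g t) -> g @ F --> 0 -> f @ F --> l.
Proof.
move=> fg /cvgrPdist_lt g0; apply/cvgrPdist_lt => e e0.
move: fg (g0 _ e0); apply: filterS2 => t h1; rewrite sub0r normrN => h2.
by rewrite distrC (le_lt_trans h1)// (le_lt_trans (ler_norm _)).
Qed.

Lemma cvg_dist0 T (F : set_system T) {FF : Filter F} (f : T -> V) l :
  f @ F --> l -> `|f t - l| @[t --> F] --> (0 : R).
Proof.
move=> /cvgrPdist_lt fl; apply/cvgrPdist_lt => e e0.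
by move: (fl _ e0); apply: filterS => t; rewrite sub0r normrN normr_id distrC.
Qed.

Lemma sqr_norm_cvg0 T (F : set_system T) {FF : Filter F} (f : T -> V) :
  `|f t| ^+ 2 @[t --> F] --> (0 : R) -> f @ F --> (0 : V).
Proof.
move=> /cvgrPdist_lt f0; apply/cvgrPdist_lt => e e0.
move: (f0 _ (exprn_gt0 2 e0)); apply: filterS => t.
by rewrite !sub0r !normrN normrX normr_id ltr_sqr ?nnegrE// ltW.
Qed.

Lemma cvg_ler T (F : set_system T) {FF : ProperFilter F} (f g : T -> R)
    (l m : R) :
  (forall t, f t <= g t) -> f @ F --> l -> g @ F --> m -> l <= m.
Proof.
move=> fg fl gm; rewrite -subr_ge0.
apply: (@closed_cvg _ _ F _ (fun t => g t - f t) (fun r : R => 0 <= r)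
  (@closed_ge R _)).
  by apply: (@filterE _ F) => t; rewrite subr_ge0.
exact: cvgB.
Qed.

End Limits.

Section Topology.
Context {R : realType} {H : hilbertType R}.
Implicit Types (x y z u v : H).

Lemma cvg_ip T (F : set_system T) {FF : Filter F} (f g : T -> H) x y :
  f @ F --> x -> g @ F --> y -> ip (f t) (g t) @[t --> F] --> ip x y.
Proof.
move=> fx gy.
apply: (cvg_dist_le (g :=
  fun t => `|f t - x| * `|g t| + `|x| * `|g t - y|)).
  apply: nearW => t; rewrite (_ : _ - _ =
    ip (f t - x) (g t) + ip x (g t - y)); last by rewrite !ipE; ring.
  by apply: le_trans (ler_normD _ _) _; apply: lerD; exact: normr_ip_le.
rewrite -[0 : R](_ : 0 * `|y| + `|x| * 0 = 0); last first.
  by rewrite mul0r mulr0 addr0.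
apply: cvgD; apply: cvgM.
- exact: cvg_dist0.
- exact: cvg_norm.
- exact: cvg_cst.
- exact: cvg_dist0.
Qed.

(** Approximate minimizers with tolerance 1/(n+1) satisfy such a bound, which makes them a Cauchy
    sequence. *)
Lemma fast_cauchy_cvg (x_ : nat -> H) (K : R) :
  (forall n k, `|x_ n - x_ k| ^+ 2 <= K * (n.+1%:R^-1 + k.+1%:R^-1)) ->
  exists x, x_ @ \oo --> x.
Proof.
move=> h; suff : cvg (x_ @ \oo) by move=> c; exists (lim (x_ @ \oo)).
apply/cauchy_cvgP/cauchyP => e e0.
(* [|K| + 1] is a positive majorant of [K], whose sign is not known. *)
have : 0 < e ^+ 2 / (2 * (`|K| + 1)).
  by rewrite divr_gt0 ?exprn_gt0// mulr_gt0// ltr_wpDl.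
move=> d0; have [N _ hN] := near_infty_natSinv_lt (PosNum d0).
have K0 : 0 < `|K| + 1 by rewrite ltr_wpDl.
exists (x_ N); exists N => //= n Nn; rewrite -ball_normE /=.
rewrite -ltr_sqr ?nnegrE// ?ltW//; apply: le_lt_trans (h _ _) _.
have := hN _ Nn; have := hN _ (leqnn N) => /=.
rewrite !ltr_pdivlMr ?mulr_gt0// => h1 h2.
have k0 : 0 <= N.+1%:R^-1 + n.+1%:R^-1 :> R by rewrite addr_ge0.
apply: (le_lt_trans (y := (`|K| + 1) * (N.+1%:R^-1 + n.+1%:R^-1))).
  by rewrite ler_wpM2r// (le_trans (ler_norm _))// lerDl.
by move: k0 h1 h2; move: (_^-1) (_^-1) => a b; lra.
Qed.

(* The variational inequality characterizing the minimizer of the function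
   (x, u, t) |-> t + (|x|^2 + |u|^2) / 2 over a closed convex set. *)
Lemma convex_quadratic_min (C : H -> H -> R -> Prop) (m0 : R) :
  (forall x u t x' u' t' s, 0 <= s <= 1 -> C x u t -> C x' u' t' ->
     C (x + s *: (x' - x)) (u + s *: (u' - u)) (t + s * (t' - t))) ->
  (forall (x_ u_ : nat -> H) (t_ : nat -> R) x u t,
     (forall n, C (x_ n) (u_ n) (t_ n)) ->
     x_ @ \oo --> x -> u_ @ \oo --> u -> t_ @ \oo --> t -> C x u t) ->
  (exists x u t, C x u t) ->
  (forall x u t, C x u t -> m0 <= t + (ip x x + ip u u) / 2) ->
  exists x u t, C x u t /\ forall x' u' t', C x' u' t' ->
    0 <= t' - t + ip x (x' - x) + ip u (u' - u).
Proof.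
move=> Cconv Cclosed [x0 [u0 [t0 C0]]] Clb.
pose q x u t := t + (ip x x + ip u u) / 2.
pose E := [set r | exists x u t, C x u t /\ r = q x u t].
have infE : has_inf E.
  split; first by exists (q x0 u0 t0), x0, u0, t0.
  by exists m0 => _ [x [u [t [Cxut ->]]]]; exact: Clb.
pose m := inf E.
have mq x u t : C x u t -> m <= q x u t.
  by move=> Cxut; apply: ge_inf; [case: infE|exists x, u, t].
have /choice[z hz] n : exists z : H * H * R,
    C z.1.1 z.1.2 z.2 /\ q z.1.1 z.1.2 z.2 < m + n.+1%:R^-1.
  have n0 : 0 < n.+1%:R^-1 :> R by rewrite invr_gt0 ltr0Sn.
  have [_ [x [u [t [Cxut ->]]]] ltq] := inf_adherent n0 infE.
  by exists (x, u, t).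
pose x_ n := (z n).1.1; pose u_ n := (z n).1.2; pose t_ n := (z n).2.
(* The midpoint of two points of [C] is in [C]; as [q] is affine in t, the parallelogram identity
   turns the bound [m <= q] there into this estimate. *)
have par n k : `|x_ n - x_ k| ^+ 2 + `|u_ n - u_ k| ^+ 2 <=
    4 * (n.+1%:R^-1 + k.+1%:R^-1).
  have [Cn qn] := hz n; have [Ck qk] := hz k.
  have := mq _ _ _ (Cconv _ _ _ _ _ _ 2^-1 _ Cn Ck).
  rewrite -/(x_ n) -/(u_ n) -/(t_ n) -/(x_ k) -/(u_ k) -/(t_ k) in qn qk *.
  move=> /(_ ltac:(lra)); move: qn qk; rewrite /q !sqr_norm_ip !ipE.
  rewrite (ipC (x_ k) (x_ n)) (ipC (u_ k) (u_ n)).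
  by move: (n.+1%:R^-1) (k.+1%:R^-1) => a b; lra.
have [x xx] : exists x, x_ @ \oo --> x.
  apply: (fast_cauchy_cvg (K := 4)) => n k; apply: le_trans (par n k).
  by rewrite lerDl sqr_ge0.
have [u uu] : exists u, u_ @ \oo --> u.
  apply: (fast_cauchy_cvg (K := 4)) => n k; apply: le_trans (par n k).
  by rewrite lerDr sqr_ge0.
have qm : q (x_ n) (u_ n) (t_ n) @[n --> \oo] --> m.
  apply: (cvg_dist_le (g := fun n => n.+1%:R^-1)); last exact: cvg_harmonic.
  apply: nearW => n; have [Cn qn] := hz n.
  rewrite ger0_norm ?subr_ge0; last exact: mq Cn.
  by rewrite lerBlDl ltW.
(* No estimate controls [t_] directly: it converges as the difference of [q], which tends to m, and
   its quadratic part. *)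
have tt : t_ @ \oo --> m - (ip x x + ip u u) / 2.
  rewrite (_ : t_ = fun n => q (x_ n) (u_ n) (t_ n) -
      (ip (x_ n) (x_ n) + ip (u_ n) (u_ n)) / 2); last first.
    by apply/funext => n; rewrite /q addrK.
  apply: cvgB => //; apply: cvgM; last exact: cvg_cst.
  by apply: cvgD; exact: cvg_ip.
exists x, u, (m - (ip x x + ip u u) / 2).
have Cz : C x u (m - (ip x x + ip u u) / 2).
  by apply: (Cclosed x_ u_ t_) => // n; case: (hz n).
split=> // x' u' t' Cz'.
set D := _ + _.
pose K := (ip (x' - x) (x' - x) + ip (u' - u) (u' - u)) / 2.
have K0 : 0 <= K by rewrite divr_ge0// addr_ge0// ip_ge0.
(* Minimality along the segment towards the competitor reads 0 <= s D + s^2 K; then s is divided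
   out. *)
have DK (s : R) : 0 < s <= 1 -> 0 <= D + s * K.
  move=> /andP[s0 s1].
  have := mq _ _ _ (Cconv _ _ _ _ _ _ s _ Cz Cz').
  rewrite (ltW s0) s1 => /(_ isT).
  rewrite /q -(pmulr_rge0 _ s0) /D /K -subr_ge0 !ipE (ipC x' x) (ipC u' u).
  by congr (0 <= _); field.
rewrite leNgt; apply/negP => D0.
(* With this s, s K <= - D / 2, so that D + s K <= D / 2 < 0. *)
have := DK (Num.min 1 (- D / (2 * (K + 1)))).
have pos : 0 < - D / (2 * (K + 1)) by rewrite divr_gt0// ?oppr_gt0//; lra.
rewrite lt_min ltr01 pos ge_min lexx => /(_ isT).
apply/negP; rewrite -ltNge.
have : Num.min 1 (- D / (2 * (K + 1))) * K <= (- D / (2 * (K + 1))) * (K + 1).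
  apply: ler_pM => //; last by lra.
    by rewrite le_min ler01 ltW.
  by rewrite ge_min lexx orbT.
have -> : - D / (2 * (K + 1)) * (K + 1) = - D / 2 by field; lra.
lra.
Qed.

End Topology.

(** * The theorems of Riesz and Minty *)

Section Hilbert.
Context {R : realType} {H : hilbertType R}.
Implicit Types (x y z u v : H).

(** A minimizer x of f(x) + |x|^2 / 2 satisfies f(h) + <x,h> >= 0 for every h; replacing h by - h
    gives equality, so - x represents f. The convex set is the epigraph of f, with the second vector
    frozen at 0. *)
Lemma riesz (f : H -> R) (K : R) :
  (forall a x y, f (a *: x + y) = a * f x + f y) ->
  (forall x, `|f x| <= K * `|x|) ->
  exists w, forall x, f x = ip w x.
Proof.
move=> flin fK.
have fD x y : f (x + y) = f x + f y.
  by have := flin 1 x y; rewrite scale1r mul1r.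
have f0 : f 0 = 0 by have := fD 0 0; rewrite addr0; lra.
have fZ a x : f (a *: x) = a * f x by have := flin a x 0; rewrite f0 !addr0.
have fN x : f (- x) = - f x by rewrite -scaleN1r fZ mulN1r.
have [||||x [u [t [[u0 xt] xmin]]]] :=
  @convex_quadratic_min R H (fun x u t => u = 0 /\ f x <= t) (- (K ^+ 2 / 2)).
- move=> x u t x' u' t' s /andP[s0 s1] [-> h] [-> h']; split.
    by rewrite subr0 scaler0 addr0.
  rewrite fD fZ fD fN.
  have := ler_wpM2l s0 h'; have : 0 <= (1 - s) * (t - f x); last by lra.
  by rewrite mulr_ge0// subr_ge0.
- move=> x_ u_ t_ x u t C xx uu tt; split.
    have uE : u_ = fun=> 0 by apply/funext => n; case: (C n).
    by move: uu; rewrite uE => uu; exact: (norm_cvg_unique uu (cvg_cst _)).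
  have fx : f (x_ n) @[n --> \oo] --> f x.
    apply: (cvg_dist_le (g := fun n => K * `|x_ n - x|)).
      by apply: nearW => n; rewrite -fN -fD.
    by rewrite -(mulr0 K); apply: cvgM; [exact: cvg_cst|exact: cvg_dist0].
  by apply: (ler_cvg_to fx tt); apply: nearW => n; case: (C n).
- by exists 0, 0, 0; split=> //; rewrite f0.
(* Since f(x) >= - K |x|, completing the square gives the lower bound - K^2 / 2. *)
- move=> x u t [-> xt]; rewrite ip0l addr0 -sqr_norm_ip.
  have := fK x; rewrite ler_norml => /andP[h _].
  have := sqr_ge0 (K - `|x|); rewrite sqrrB; lra.
have tE : t = f x.
  apply/eqP; rewrite eq_le xt andbT.
  have := xmin x 0 (f x) (conj erefl (lexx _)).
  by rewrite u0 !subrr !ip0r !addr0 subr_ge0.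
have xge h : 0 <= f h + ip x h.
  have := xmin (x + h) 0 (f (x + h)) (conj erefl (lexx _)).
  by rewrite u0 subrr ip0r addr0 tE fD [x + h]addrC addrK; lra.
exists (- x) => h; rewrite !ipE; apply/eqP; rewrite eq_le.
have := xge h; have := xge (- h).
by rewrite fN !ipE => h1 h2; apply/andP; split; lra.
Qed.

(** Adjoining (x, u) to the graph of A keeps it monotone, so by maximality the point is already
    there. *)
Lemma maximally_monotone_mem (A : H -> set H) x u : maximally_monotone A ->
  (forall y v, A y v -> 0 <= ip (x - y) (u - v)) -> A x u.
Proof.
move=> [Amon Amax] h.
pose S y := A y `|` [set v | y = x /\ v = u].
have Smon y y' v v' : S y v -> S y' v' -> 0 <= ip (y - y') (v - v').
  move=> [Ay|[-> ->]] [Ay'|[-> ->]].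
  - exact: Amon Ay Ay'.
  - by rewrite -(opprB x y) -(opprB u v) ipNl ipNr opprK h.
  - exact: h.
  - by rewrite !subrr ip0l.
have SA : graph_op S = graph_op A.
  by apply: Amax => [? ? ? ?|? ?]; [exact: Smon|left].
have : graph_op S (x, u) by right.
by rewrite SA.
Qed.

(* The minimizer of F(x, u) + (|x|^2 + |u|^2) / 2, where F is the Fitzpatrick
   function F(x, u) = sup {<x, v> + <y, u> - <y, v> | v \in T y}, encoded by its
   epigraph. If (a, b) is this minimizer, then (- b, - a) is monotonically related
   to the graph of T up to an excess |a + b|^2, which must therefore vanish. *)
Lemma minty0 (T : H -> set H) :
  (forall x u y v, T x u -> T y v -> 0 <= ip (x - y) (u - v)) ->
  (forall x u, (forall y v, T y v -> 0 <= ip (x - y) (u - v)) -> T x u) ->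
  exists a, T a (- a).
Proof.
move=> Tmon Tmax.
have [y0 [v0 T0]] : exists y v, T y v.
  apply: contrapT => /forallNP h; apply: (h 0); exists 0.
  by apply: Tmax => y v Tyv; case: (h y); exists v.
pose C x u t := forall y v, T y v -> ip x v + ip y u - ip y v <= t.
(* The Fitzpatrick function dominates <x,u>: if t < <x,u>, then (x, u) is monotonically related to
   T, hence in its graph, and testing [C] at (x, u) itself gives <x,u> <= t. *)
have Cip x u t : C x u t -> ip x u <= t.
  move=> Cxut; rewrite leNgt; apply/negP => tlt.
  suff /Cxut : T x u by lra.
  by apply: Tmax => y v /Cxut; rewrite !ipE; lra.
have CT x u : T x u -> C x u (ip x u).
  by move=> Tx y v Ty; have := Tmon _ _ _ _ Tx Ty; rewrite !ipE; lra.
have [||||a [b [t [Cab abmin]]]] := @convex_quadratic_min R H C 0.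
- move=> x u t x' u' t' s /andP[s0 s1] h h' y v Ty; rewrite !ipE.
  have := ler_wpM2l s0 (h' _ _ Ty).
  have s1' : 0 <= 1 - s by lra.
  have := ler_wpM2l s1' (h _ _ Ty); lra.
- move=> x_ u_ t_ x u t h xx uu tt y v Ty.
  have lim : ip (x_ n) v + ip y (u_ n) - ip y v @[n --> \oo] -->
      ip x v + ip y u - ip y v.
    apply: cvgB; last exact: cvg_cst.
    by apply: cvgD; apply: cvg_ip => //; exact: cvg_cst.
  by apply: (ler_cvg_to lim tt); apply: nearW => n; exact: h.
- by exists y0, v0, (ip y0 v0); exact: CT.
(* As t >= <x,u>, the objective is at least |x + u|^2 / 2. *)
- move=> x u t /Cip; have := ip_ge0 (x + u); rewrite !ipE (ipC u x); lra.
have excess x u : T x u -> ip (a + b) (a + b) <= ip (- b - x) (- a - u).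
  move=> Tx; have := abmin _ _ _ (CT _ _ Tx); have := Cip _ _ _ Cab.
  by rewrite !ipE (ipC b a) (ipC x a); lra.
have Tba : T (- b) (- a).
  by apply: Tmax => y v /excess; apply: le_trans; exact: ip_ge0.
have := excess _ _ Tba; rewrite !subrr ip0l -sqr_norm_ip exprn_even_le0//=.
by rewrite normr_eq0 addr_eq0 => /eqP ab; exists a; rewrite {1}ab.
Qed.

(** This is [minty0] for the operator y |-> c A y - z, which inherits both of its hypotheses from
    A. *)
Lemma minty (A : H -> set H) (c : R) z : maximally_monotone A -> 0 < c ->
  exists y, A y (c^-1 *: (z - y)).
Proof.
move=> Amax c0.
have [x u y v Ax Ay|x u h|a Aa] :=
    @minty0 (fun y => [set v | A y (c^-1 *: (v + z))]).
- have := Amax.1 _ _ _ _ Ax Ay; rewrite -/(ip _ _).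
  by rewrite -scalerBr opprD addrACA subrr addr0 ipZr pmulr_rge0// invr_gt0.
- apply: (maximally_monotone_mem Amax) => y v Ay.
  have := h y (c *: v - z); rewrite /= subrK scalerA mulVf ?gt_eqF// scale1r.
  move=> /(_ Ay); rewrite (_ : u - (c *: v - z) = c *: (c^-1 *: (u + z) - v)).
    by rewrite ipZr pmulr_rge0.
  by rewrite scalerBr scalerA mulfV ?gt_eqF// scale1r opprB addrA addrAC.
- by exists a; move: Aa; rewrite /= addrC.
Qed.

(** Minty's theorem rules out the default value of [resolvent], and the chosen point satisfies its
    defining inclusion. *)
Lemma resolventP (A : H -> set H) (c : R) z : maximally_monotone A -> 0 < c ->
  A (resolvent (op_scale c A) z) (c^-1 *: (z - resolvent (op_scale c A) z)).
Proof.
move=> Amax c0.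
have [y Ay] := minty z Amax c0.
rewrite /resolvent; case: xgetP => [p _|/(_ y)].
  move=> [_ -> [_ [v Av <-] <-]] /=.
  by rewrite addrC addKr scalerA mulVf ?gt_eqF// scale1r.
case; exists y => //; exists (z - y); last by rewrite addrC subrK.
by exists (c^-1 *: (z - y)) => //; rewrite scalerA mulfV ?gt_eqF// scale1r.
Qed.

End Hilbert.

(** * Weak limits along ultrafilters *)

Section Ultrafilters.
Context {R : realType} {H : hilbertType R}.
Implicit Types (x y z u v w : H).

Lemma zer_sumP (A : H -> set H) (B : H -> H) w :
  zer_op (op_add A (op_of_fun B)) w <-> A w (- B w).
Proof.
split=> [[u Au [_ -> /eqP]]|Aw].
  by rewrite addr_eq0 => /eqP <-.
by exists (- B w) => //; exists (B w) => //; rewrite addNr.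
Qed.

(** Maximality of A + B, tested at (w, 0). With c = 1 / (2 beta), let y be the resolvent of c A at w
    - c B w. The hypothesis at y gives 2 beta |w - y|^2 <= <w - y, B w - B y> <= beta |w - y|^2, so
    y = w. *)
Lemma zer_sum_mem (A : H -> set H) (B : H -> H) (beta : R) w :
  maximally_monotone A -> 0 < beta ->
  (forall x y, `|B x - B y| <= beta * `|x - y|) ->
  (forall y v, A y v -> ip (w - y) (v + B y) <= 0) -> A w (- B w).
Proof.
move=> Amax b0 Blip h.
have c0 : 0 < (2 * beta)^-1 by rewrite invr_gt0; lra.
have [y] := minty (w - (2 * beta)^-1 *: B w) Amax c0.
rewrite invrK => Ay.
have E : 2 * beta *: (w - (2 * beta)^-1 *: B w - y) = 2 * beta *: (w - y) - B w.
  by rewrite addrAC scalerBr scalerA mulfV ?scale1r// gt_eqF//; lra.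
have := h _ _ Ay; rewrite E -addrA [- _ + _]addrC ipDr ipZr -sqr_norm_ip.
have := ip_le (w - y) (B w - B y); rewrite -[B w - B y]opprB ipNr.
have := ler_wpM2l (normr_ge0 (w - y)) (Blip w y); rewrite -[B w - B y]opprB.
have := sqr_ge0 `|w - y|.
set n := `|w - y| => n0 h1 h2 h3.
have : beta * n ^+ 2 <= 0 by lra.
rewrite pmulr_rle0// exprn_even_le0//= normr_eq0 subr_eq0 => /eqP wy.
by move: Ay; rewrite E -wy subrr scaler0 sub0r.
Qed.

(** If the preimage of a neighbourhood is not in F, then the trace of F on its complement is proper,
    and an ultrafilter extending this trace contradicts the hypothesis. *)
Lemma cvg_ultra T (F : set_system T) (V : topologicalType) (f : T -> V)
    (l : V) :
  Filter F ->
  (forall U, UltraFilter U -> F `<=` U -> f @ U --> l) -> f @ F --> l.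
Proof.
move=> FF h S Sl; apply: contrapT => nFS.
have WF : ProperFilter (within (~` (f @^-1` S)) F).
  split; last exact: within_filter.
  rewrite /within /= => F0; apply: nFS; apply: filterS F0 => t h0.
  by apply: contrapT => ?; exact: h0.
have [U [UU WU]] := ultraFilterLemma WF.
have FU : F `<=` U by move=> P FP; apply: WU; apply: filterS FP.
have US := h U UU FU S Sl.
have /WU US' : within (~` (f @^-1` S)) F (~` (f @^-1` S)).
  by apply: nearW.
have : U set0 by rewrite -(setICr (f @^-1` S)); exact: filterI.
exact: filter_not_empty.
Qed.

(** By compactness of [-K, K] there is a cluster point, and a cluster point of an ultrafilter is a
    limit. *)
Lemma ultra_bounded_cvg T (U : set_system T) (f : T -> R) (K : R) :
  UltraFilter U -> (forall t, `|f t| <= K) -> exists l : R, f @ U --> l.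
Proof.
move=> UU fK.
have fU : (f @ U) `[- K, K]%classic.
  by apply: nearW => t /=; rewrite in_itv /= -ler_norml.
have PU : ProperFilter U by exact: ultra_proper.
have [l [_ cl]] := @segment_compact R (- K) K (f @ U) _ fU.
exists l => S Sl; have [//|nS] := in_ultra_setVsetC (f @^-1` S) UU.
by have [r []] := cl (~` S) S nS Sl.
Qed.

(** The limits of <f(t), y> depend linearly on y and are bounded by K |y|, so [riesz] represents
    them. *)
Lemma ultra_weak_limit T (U : set_system T) (f : T -> H) (K : R) :
  UltraFilter U -> (forall t, `|f t| <= K) ->
  exists w, forall y, ip (f t) y @[t --> U] --> ip w y.
Proof.
move=> UU fK; have PU : ProperFilter U by exact: ultra_proper.
have fyK y t : `|ip (f t) y| <= K * `|y|.
  by apply: le_trans (normr_ip_le _ _) _; rewrite ler_wpM2r.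
have /choice[g hg] y : exists l : R, ip (f t) y @[t --> U] --> l.
  exact: ultra_bounded_cvg UU (fyK y).
have [||w gw] := @riesz R H g K.
- move=> a x y; apply: (norm_cvg_unique (hg (a *: x + y))).
  rewrite (_ : (fun t => _) = (fun t => a * ip (f t) x + ip (f t) y)).
    exact: (cvgD (cvgM (cvg_cst a) (hg x)) (hg y)).
  by apply/funext => t; rewrite ipDr ipZr.
- move=> y; apply: (@closed_cvg _ _ U _ (fun t => `|ip (f t) y|)
    (fun r : R => r <= K * `|y|) (@closed_le R _)).
    exact: filterE (fyK y).
  exact: cvg_norm (hg y).
by exists w => y; rewrite -gw.
Qed.

(** Two weak limits w and w' along ultrafilters lie in Z, so <x_n, w - w'> converges; its limit is
    both <w, w - w'> and <w', w - w'>, whence w = w'. *)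
Lemma opial (x_ : nat -> H) (Z : set H) (K : R) :
  (forall n, `|x_ n| <= K) ->
  (forall z, Z z -> cvg (`|x_ n - z| ^+ 2 @[n --> \oo])) ->
  (forall U w, UltraFilter U -> \oo `<=` U ->
    (forall y, ip (x_ n) y @[n --> U] --> ip w y) -> Z w) ->
  exists2 w, Z w & forall y, ip (x_ n) y @[n --> \oo] --> ip w y.
Proof.
move=> xK xZ xU.
(* Polarization: 2 <x, z1 - z2> = |x - z2|^2 - |x - z1|^2 + |z1|^2 - |z2|^2. *)
have uniq z1 z2 : Z z1 -> Z z2 -> cvg (ip (x_ n) (z1 - z2) @[n --> \oo]).
  move=> /xZ /cvg_ex[l1 c1] /xZ/cvg_ex[l2 c2]; apply/cvg_ex.
  exists ((l2 - l1 + (ip z1 z1 - ip z2 z2)) / 2).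
  rewrite (_ : (fun n => _) = fun n =>
     (`|x_ n - z2| ^+ 2 - `|x_ n - z1| ^+ 2 + (ip z1 z1 - ip z2 z2)) / 2).
    exact: (cvgM (cvgD (cvgB c2 c1) (cvg_cst _)) (cvg_cst _)).
  apply/funext => n; rewrite !sqr_norm_ip !ipE (ipC z1 (x_ n)) (ipC z2 (x_ n)).
  by field.
have [U0 [UU0 ooU0]] := ultraFilterLemma eventually_filter.
have [w hw] := ultra_weak_limit UU0 xK.
have Zw := xU _ _ UU0 ooU0 hw.
exists w => // y; apply: cvg_ultra => U UU ooU.
have [w' hw'] := ultra_weak_limit UU xK.
have Zw' := xU _ _ UU ooU hw'.
suff -> : w = w' by [].
have /cvg_ex[l cl] := uniq _ _ Zw Zw'.
have c0 : ip (x_ n) (w - w') @[n --> U0] --> l.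
  by apply: cvg_trans cl; exact: cvg_app.
have c1 : ip (x_ n) (w - w') @[n --> U] --> l.
  by apply: cvg_trans cl; exact: cvg_app.
have e0 := norm_cvg_unique c0 (hw _); have e1 := norm_cvg_unique c1 (hw' _).
apply/eqP; rewrite -subr_eq0 -normr_eq0 -sqrf_eq0 sqr_norm_ip ipDl ipNl.
by rewrite -e0 -e1 subrr.
Qed.

End Ultrafilters.

(** * The inertial recursion *)

Section Inertial.
Context {R : realType}.

Lemma nneseries_lty_bounded (f : nat -> R) m (S : R) :
  (forall n, 0 <= f n) -> (forall n, \sum_(m <= i < n) f i <= S) ->
  (\sum_(m <= i <oo) (f i)%:E < +oo)%E.
Proof.
move=> f0 fS; apply: (@le_lt_trans _ _ S%:E); last exact: ltry.
apply: lime_le; first by apply: is_cvg_nneseries => n _ _; rewrite lee_fin.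
by apply: nearW => n; rewrite sumEFin lee_fin.
Qed.

(* phi_(n+1) - a_n phi_n + mu d_n is a Lyapunov function. *)
Lemma inertial_sequence (phi a d e : nat -> R) (alpha mu tau : R) :
  (forall n, 0 <= phi n) -> (forall n, 0 <= d n) -> (forall n, 0 <= e n) ->
  0 <= mu -> 0 < tau -> alpha < 1 ->
  (forall n, 0 <= a n <= alpha) -> (forall n, a n <= a n.+1) ->
  (forall n, phi n.+2 - phi n.+1 - a n * (phi n.+1 - phi n) +
    (mu + tau) * d n.+1 + tau * e n <= mu * d n) ->
  [/\ (exists M, forall n, phi n <= M),
      (exists S, forall n, \sum_(0 <= i < n) d i <= S),
      (exists S, forall n, \sum_(0 <= i < n) e i <= S),
      d @ \oo --> 0 /\ e @ \oo --> 0
    & phi n.+1 - phi n @[n --> \oo] --> 0 -> cvg (phi @ \oo)].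
Proof.
move=> phi0 d0 e0 mu0 tau0 al1 a_bnd a_mono step.
have a0 n : 0 <= a n by case/andP: (a_bnd n).
have aal n : a n <= alpha by case/andP: (a_bnd n).
pose V n := phi n.+1 - a n * phi n + mu * d n.
(* Since a is nondecreasing, a_n phi_(n+1) can be replaced by a_(n+1) phi_(n+1). *)
have VS n : tau * d n.+1 + tau * e n <= V n - V n.+1.
  have := step n; have := ler_wpM2r (phi0 n.+1) (a_mono n); rewrite /V; lra.
have Vdec n : V n.+1 <= V n.
  have := VS n; have := mulr_ge0 (ltW tau0) (d0 n.+1).
  have := mulr_ge0 (ltW tau0) (e0 n); lra.
have V0 n : V n <= V 0 by elim: n => // n; apply: le_trans.
(* M is chosen so that M >= phi_0 and V_0 + alpha M <= M, which makes the bound on phi inductive. *)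
pose M := phi 0 + `|V 0| / (1 - alpha).
have V0M : V 0 <= (1 - alpha) * M.
  rewrite mulrDr mulrCA mulfV ?mulr1; last lra.
  by apply: le_trans (ler_norm _) _; rewrite lerDr mulr_ge0//; lra.
have phiM n : phi n <= M.
  elim: n => [|n IH]; first by rewrite lerDl divr_ge0//; lra.
  have h := V0 n; rewrite {1}/V in h.
  have := ler_pM (a0 n) (phi0 n) (aal n) IH; have := mulr_ge0 mu0 (d0 n); lra.
have alM : 0 <= alpha * M.
  by rewrite mulr_ge0//; [exact: le_trans (aal 0)|exact: le_trans (phiM 0)].
have Vlb n : - (alpha * M) <= V n.
  have := ler_pM (a0 n) (phi0 n) (aal n) (phiM n).
  have := mulr_ge0 mu0 (d0 n); have := phi0 n.+1; rewrite /V; lra.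
have sumV n : tau * \sum_(0 <= i < n) d i.+1 +
    tau * \sum_(0 <= i < n) e i <= V 0 - V n.
  elim: n => [|n IH]; first by rewrite !big_geq// !mulr0 addr0 subrr.
  by rewrite !big_nat_recr//=; have := VS n; lra.
pose S := (V 0 + alpha * M) / tau.
have sumS n : \sum_(0 <= i < n) d i.+1 + \sum_(0 <= i < n) e i <= S.
  rewrite /S ler_pdivlMr// mulrC mulrDr; have := sumV n; have := Vlb n; lra.
have sd0 n : 0 <= \sum_(0 <= i < n) d i.+1 by apply: sumr_ge0 => i _; exact: d0.
have se0 n : 0 <= \sum_(0 <= i < n) e i by apply: sumr_ge0 => i _; exact: e0.
have cV : cvg (V @ \oo).
  apply: nonincreasing_is_cvgn; first exact/nonincreasing_seqP.
  by exists (- (alpha * M)) => _ [n _ <-].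
have dV0 : tau^-1 * (V n - V n.+1) @[n --> \oo] --> 0.
  rewrite -[X in _ --> X](_ : tau^-1 * (lim (V @ \oo) - lim (V @ \oo)) = 0); last first.
    by rewrite subrr mulr0.
  apply: cvgM; first exact: cvg_cst.
  by apply: cvgB => //; rewrite (cvg_shiftS V).
have small (f : nat -> R) : (forall n, 0 <= f n) ->
    (forall n, tau * f n <= V n - V n.+1) -> f @ \oo --> 0.
  move=> f0 h; apply: (cvg_dist_le _ dV0); apply: nearW => n.
  by rewrite subr0 ger0_norm// ler_pdivlMl.
have dto0 : d @ \oo --> 0.
  rewrite -(cvg_shiftS d); apply: small => n /=; first exact: d0.
  by have := VS n; have := mulr_ge0 (ltW tau0) (e0 n); lra.
split.
- by exists M.
- exists (d 0 + S) => -[|n].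
    by have := sumS 0; have := d0 0; rewrite !big_geq//; lra.
  by rewrite big_nat_recl// lerD2l; have := sumS n; have := se0 n; lra.
- by exists S => n; have := sumS n; have := sd0 n; lra.
- split=> //; apply: small => // n.
  by have := VS n; have := mulr_ge0 (ltW tau0) (d0 n.+1); lra.
move=> dphi.
have ca : cvg (a @ \oo).
  apply: nondecreasing_is_cvgn; first exact/nondecreasing_seqP.
  by exists alpha => _ [n _ <-].
have la : lim (a @ \oo) <= alpha by apply: limr_le => //; exact: nearW.
pose l := (lim (V @ \oo) - mu * 0 - lim (a @ \oo) * 0) / (1 - lim (a @ \oo)).
apply: (cvgP l); rewrite -(cvg_shiftS phi).
(* Solving the definition of V for phi_(n+1): V_n - mu d_n - a_n (phi_(n+1) - phi_n) = (1 - a_n)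
   phi_(n+1). *)
rewrite (_ : (fun n => _) = fun n =>
    (V n - mu * d n - a n * (phi n.+1 - phi n)) / (1 - a n)); last first.
  apply/funext => n; rewrite /V; field.
  by have := aal n; lra.
apply: cvgM; last first.
  apply: cvgV; first lra.
  by apply: cvgB => //; exact: cvg_cst.
apply: cvgB; first by apply: cvgB => //; apply: cvgM => //; exact: cvg_cst.
exact: cvgM.
Qed.

End Inertial.

(** * The estimate for one iteration *)

Section Step.
Context {R : realType} {H : hilbertType R}.

(** Everything is expressed through g = p - z, w = x - p, d = x - y and e = c (B x - B p).
    Monotonicity gives <g, w - e + a1 d> >= 0, which absorbs all inner products with g; the
    Lipschitz bound on e and Young-type inequalities leave a combination of |w|^2 and |d|^2 only. *)
Lemma inertial_step (A : H -> set H) (B : H -> H) (x y z p : H)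
    (c beta sigma alpha1 alpha2 a1 a2 : R) :
  let x' := p + c *: (B x - B p) + a2 *: (x - y) in
  let mu := 2 * (alpha1 + alpha2) + 3 * alpha2 ^+ 2 in
  monotone_op A -> monotone_op (op_of_fun B) ->
  (forall x y, `|B x - B y| <= beta * `|x - y|) ->
  A z (- B z) -> A p (c^-1 *: (x - c *: B x + a1 *: (x - y) - p)) ->
  0 < c -> 0 < beta -> 0 < sigma -> 0 <= a1 <= alpha1 -> 0 <= a2 <= alpha2 ->
  (beta * c) ^+ 2 * (12 * alpha2 ^+ 2 + 8 * (alpha1 + alpha2) + 4 * sigma + 2) <=
    1 - 12 * alpha2 ^+ 2 - 9 * (alpha1 + alpha2) - 4 * sigma ->
  `|x' - z| ^+ 2 - `|x - z| ^+ 2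
    - (a1 + a2) * (`|x - z| ^+ 2 - `|y - z| ^+ 2)
    + (mu + sigma / 2) * `|x' - x| ^+ 2 + 2 * sigma * `|x - p| ^+ 2
  <= mu * `|x - y| ^+ 2.
Proof.
move=> x' mu Amon Bmon Blip Az Ap c0 b0 s0 /andP[a10 a1le] /andP[a20 a2le] hL.
pose g := p - z; pose w := x - p; pose d := x - y; pose e := c *: (B x - B p).
have gw : 0 <= ip g (w - e + a1 *: d).
  have h1 : 0 <= ip (p - z) _ := Amon _ _ _ _ Ap Az.
  have h2 : 0 <= ip (p - z) (B p - B z) by exact: Bmon.
  have := addr_ge0 h1 h2; rewrite -ipDr -(pmulr_rge0 _ c0) -ipZr.
  congr (0 <= ip _ _); apply: ip_inj => h; rewrite !ipE; field.
  by rewrite gt_eqF.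
have eL : ip e e <= (beta * c) ^+ 2 * ip w w.
  rewrite -!sqr_norm_ip -exprMn ler_sqr ?nnegrE//; last first.
    by rewrite mulr_ge0// mulr_ge0// ltW.
  rewrite normrZ gtr0_norm// [beta * c]mulrC -mulrA ler_wpM2l//; exact: ltW.
have -> : x' - z = g + (e + a2 *: d) by apply: ip_inj => h; rewrite !ipE; ring.
have -> : x' - x = e + a2 *: d - w by apply: ip_inj => h; rewrite !ipE; ring.
have -> : x - z = g + w by apply: ip_inj => h; rewrite !ipE; ring.
have -> : y - z = g + w - d by apply: ip_inj => h; rewrite !ipE; ring.
rewrite -/w -/d !sqr_norm_ip; clearbody g w d e.
set L := (beta * c) ^+ 2 in eL hL.
have L0 : 0 <= L by exact: sqr_ge0.
pose nu := mu + sigma / 2.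
have a220 : 0 <= alpha2 ^+ 2 by exact: sqr_ge0.
have nu0 : 0 <= nu by rewrite /nu /mu; lra.
(* The step-size bound, regrouped into the form that makes the coefficient of |w|^2 nonpositive. *)
have gap : 4 * (1 + L) * (nu + sigma / 2) <= 1 - (alpha1 + alpha2) - 2 * L.
  by rewrite /nu /mu; move: hL; lra.
have Lnu : 0 <= L * nu by exact: mulr_ge0.
have Ls : 0 <= L * sigma by exact: mulr_ge0 L0 (ltW s0).
have nu2 : 2 * nu <= 1 by lra.
have a22 : a2 ^+ 2 <= alpha2 ^+ 2 by rewrite ler_sqr ?nnegrE//; lra.
have coefW : 2 * L + 4 * L * nu - 1 + (a1 + a2) + 4 * nu + 2 * sigma <= 0.
  by lra.
have coefD : 2 * a2 ^+ 2 + 2 * (a1 + a2) + a2 ^+ 2 * (2 * nu) <= mu.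
  have := ler_wpM2l (sqr_ge0 a2) nu2; rewrite /mu; lra.
have w0 := ip_ge0 w; have d0 := ip_ge0 d.
have fe : ip (e + a2 *: d) (e + a2 *: d) <=
    2 * (L * ip w w) + 2 * a2 ^+ 2 * ip d d.
  have := ip_ge0 (e - a2 *: d); move: eL; rewrite !ipE; lra.
have fw : ip (e + a2 *: d - w) (e + a2 *: d - w) <=
    4 * (L * ip w w) + 4 * ip w w + 2 * a2 ^+ 2 * ip d d.
  have := ip_ge0 (e - w - a2 *: d); have := ip_ge0 (e + w).
  by move: eL; rewrite !ipE ?(ipC w e) ?(ipC d e) ?(ipC d w); lra.
have wd : - (2 * ip w d) <= ip w w + ip d d.
  by have := ip_ge0 (w + d); rewrite !ipE (ipC d w); lra.
have a12 : 0 <= a1 + a2 by lra.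
have := ler_wpM2l a12 wd; have := ler_wpM2l nu0 fw.
have := ler_wpM2r w0 coefW; have := ler_wpM2r d0 coefD.
move: gw fe; rewrite -/nu.
rewrite [ip (g + _) (g + _)]ipDl.
set f := e + a2 *: d; set X := ip (f - w) (f - w).
rewrite [ip g (g + f)]ipDr [ip f (g + f)]ipDr (ipC f g).
have -> : ip (g + w) (g + w) = ip g g + 2 * ip g w + ip w w.
  by rewrite !ipE (ipC w g); ring.
have -> : ip (g + w - d) (g + w - d) =
    ip g g + 2 * ip g w + ip w w - 2 * ip g d - 2 * ip w d + ip d d.
  by rewrite !ipE (ipC w g) (ipC d g) (ipC d w); ring.
have -> : ip g f = ip g e + a2 * ip g d by rewrite !ipE.
rewrite !ipE; lra.
Qed.

End Step.

(** * Convergence *)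

Section StrongConvergence.
Context {R : realType} {H : hilbertType R}.

(** If |x - P_n| >= e, then phi(e) <= g_n, which fails for large n. *)
Lemma modulus_cvg (phi : R -> \bar R) (P : nat -> H) (g : nat -> R) (x : H) :
  (forall t, 0 <= t -> (0 <= phi t)%E) ->
  (forall s t, 0 <= s -> s <= t -> (phi s <= phi t)%E) ->
  (forall t, 0 <= t -> (phi t = 0%E <-> t = 0)) ->
  (forall n, (phi `|x - P n|%R <= (g n)%:E)%E) -> g @ \oo --> 0 ->
  P @ \oo --> x.
Proof.
move=> phi0 phimono phiE phig g0; apply/cvgrPdist_lt => e e0.
(* phi(e) may be infinite, so a real r > 0 below it is compared with g. *)
have [r r0 rphi] : exists2 r : R, 0 < r & (r%:E <= phi e)%E.
  have : (0 < phi e)%E.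
    rewrite lt_def phi0 ?ltW// andbT; apply/eqP => /phiE.
    by move=> /(_ (ltW e0)) e00; rewrite e00 ltxx in e0.
  case: (phi e) => [r| |]//; first by rewrite lte_fin => r0; exists r.
  by move=> _; exists 1; rewrite ?leey.
move/cvgrPdist_lt : g0 => /(_ _ r0).
apply: filterS => n; rewrite sub0r normrN => gr.
rewrite ltNge; apply/negP => ex.
have := le_trans rphi (le_trans (phimono _ _ (ltW e0) ex) (phig n)).
by rewrite lee_fin leNgt (le_lt_trans (ler_norm _) gr).
Qed.

(** The inner product splits into one monotonicity term for A and one for B; one dominates the
    modulus and the other is nonnegative. *)
Lemma uniformly_monotone_cvg (A : H -> set H) (B : H -> H) (P r : nat -> H)
    (x : H) :
  monotone_op A -> monotone_op (op_of_fun B) -> A x (- B x) ->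
  (forall n, A (P n) (r n)) ->
  ip (x - P n) (- (r n + B (P n))) @[n --> \oo] --> 0 ->
  uniformly_monotone_at A x \/ uniformly_monotone_at (op_of_fun B) x ->
  P @ \oo --> x.
Proof.
move=> Amon Bmon Ax Ar g0.
have E n : ip (x - P n) (- (r n + B (P n))) =
    ip (x - P n) (- B x - r n) + ip (x - P n) (B x - B (P n)).
  by rewrite !ipE; ring.
move=> [] [_ [phi [phi0 phimono phiE phiT]]].
- apply: (modulus_cvg phi0 phimono phiE _ g0) => n.
  apply: le_trans (phiT _ _ _ Ax (Ar n : graph_op A (P n, r n))) _.
  by rewrite lee_fin E lerDl; exact: Bmon.
- apply: (modulus_cvg phi0 phimono phiE _ g0) => n.
  apply: le_trans (phiT (B x) (P n) (B (P n)) erefl erefl) _.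
  by rewrite lee_fin E lerDr; exact: Amon Ax (Ar n).
Qed.

End StrongConvergence.

Theorem theorem4 (R : realType) (H : hilbertType R)
    (A : H -> set H) (B : H -> H) (beta : R)
    (lambda sigma alpha1 alpha2 : R) (lambda_ alpha1_ alpha2_ : nat -> R)
    (x p : nat -> H) :
  maximally_monotone A ->
  monotone_op (op_of_fun B) ->
  0 < beta ->
  beta.-lipschitz B ->
  zer_op (op_add A (op_of_fun B)) !=set0 ->
  0 < lambda -> 0 < sigma -> 0 <= alpha1 -> 0 <= alpha2 ->
  12 * alpha2 ^+ 2 + 9 * (alpha1 + alpha2) + 4 * sigma < 1 ->
  (forall n, (1 <= n)%N ->
    lambda <= lambda_ n <= beta^-1 *
      Num.sqrt ((1 - 12 * alpha2 ^+ 2 - 9 * (alpha1 + alpha2) - 4 * sigma) /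
                (12 * alpha2 ^+ 2 + 8 * (alpha1 + alpha2) + 4 * sigma + 2))) ->
  (forall m n, (1 <= m)%N -> (m <= n)%N -> alpha1_ m <= alpha1_ n) ->
  alpha1_ 1%N = 0 ->
  (forall n, (1 <= n)%N -> 0 <= alpha1_ n <= alpha1) ->
  (forall m n, (1 <= m)%N -> (m <= n)%N -> alpha2_ m <= alpha2_ n) ->
  alpha2_ 1%N = 0 ->
  (forall n, (1 <= n)%N -> 0 <= alpha2_ n <= alpha2) ->
  (forall n, (1 <= n)%N ->
    p n = resolvent (op_scale (lambda_ n) A)
            (x n - lambda_ n *: B (x n) + alpha1_ n *: (x n - x n.-1))) ->
  (forall n, (1 <= n)%N ->
    x n.+1 = p n + lambda_ n *: (B (x n) - B (p n))
               + alpha2_ n *: (x n - x n.-1)) ->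
  exists2 xbar : H, zer_op (op_add A (op_of_fun B)) xbar &
    [/\ (\sum_(0 <= n <oo) (`|x n.+1 - x n| ^+ 2)%:E < +oo)%E /\
        (\sum_(1 <= n <oo) (`|x n - p n| ^+ 2)%:E < +oo)%E,
        weak_cvg x xbar /\ weak_cvg p xbar
      & demiregular_at (op_add A (op_of_fun B)) xbar \/
        (uniformly_monotone_at A xbar \/
         uniformly_monotone_at (op_of_fun B) xbar) ->
        (x @ \oo --> xbar) /\ (p @ \oo --> xbar)].

Proof.
move=> Amax Bmon b0 Blip0 [z0 /zer_sumP Az0] lam0 sig0 al10 al20 hsmall hlam
  a1mono _ a1b a2mono _ a2b hp hx.
have Amon := Amax.1.
have Blip u v : `|B u - B v| <= beta * `|u - v| by exact: (Blip0 (u, v)).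
have lamn n : lambda <= lambda_ n.+1 by case/andP: (hlam n.+1 isT).
have lamn0 n : 0 < lambda_ n.+1 by exact: lt_le_trans (lamn n).
(* The element of A p_(n+1) supplied by the resolvent. From here on the iterations are indexed from
   0. *)
pose r n := (lambda_ n.+1)^-1 *: (x n.+1 - lambda_ n.+1 *: B (x n.+1)
  + alpha1_ n.+1 *: (x n.+1 - x n) - p n.+1).
have Ar n : A (p n.+1) (r n) by rewrite /r (hp n.+1 isT); exact: resolventP.
have a220 : 0 <= alpha2 ^+ 2 by exact: sqr_ge0.
(* The upper bound on the step size, squared and cleared of denominators. *)
have hL n : (beta * lambda_ n.+1) ^+ 2 *
    (12 * alpha2 ^+ 2 + 8 * (alpha1 + alpha2) + 4 * sigma + 2) <=
    1 - 12 * alpha2 ^+ 2 - 9 * (alpha1 + alpha2) - 4 * sigma.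
  have /andP[_] := hlam n.+1 isT; set N := 1 - _ - _ - _; set D := _ + 2.
  have D0 : 0 < D by rewrite /D; lra.
  have N0 : 0 < N by rewrite /N; lra.
  rewrite -ler_pdivlMr// ler_pdivlMl// => h.
  rewrite -[leRHS]sqr_sqrtr; last by rewrite divr_ge0// ltW.
  by rewrite ler_sqr// nnegrE ?sqrtr_ge0// mulr_ge0// ltW.
pose a n := alpha1_ n.+1 + alpha2_ n.+1.
pose dx n := x n.+1 - x n; pose xp n := x n.+1 - p n.+1.
have a_bnd n : 0 <= a n <= alpha1 + alpha2.
  have /andP[? ?] := a1b n.+1 isT; have /andP[? ?] := a2b n.+1 isT.
  by rewrite /a; apply/andP; split; lra.
have a_mono n : a n <= a n.+1 by apply: lerD; [exact: a1mono|exact: a2mono].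
have step z : A z (- B z) -> forall n,
    `|x n.+2 - z| ^+ 2 - `|x n.+1 - z| ^+ 2
      - a n * (`|x n.+1 - z| ^+ 2 - `|x n - z| ^+ 2)
      + (2 * (alpha1 + alpha2) + 3 * alpha2 ^+ 2 + sigma / 2) * `|dx n.+1| ^+ 2
      + sigma / 2 * `|xp n| ^+ 2
    <= (2 * (alpha1 + alpha2) + 3 * alpha2 ^+ 2) * `|dx n| ^+ 2.
  move=> Az n.
  have := inertial_step Amon Bmon Blip Az (Ar n) (lamn0 n) b0 sig0
    (a1b n.+1 isT) (a2b n.+1 isT) (hL n).
  rewrite /= -(hx n.+1 isT) -/(a n) -/(dx n.+1) -/(dx n) -/(xp n).
  by have := mulr_ge0 (ltW sig0) (sqr_ge0 `|xp n|); lra.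
have sig2 : 0 < sigma / 2 by lra.
have mu0 : 0 <= 2 * (alpha1 + alpha2) + 3 * alpha2 ^+ 2 by lra.
have al1 : alpha1 + alpha2 < 1 by lra.
have conv z (Az : A z (- B z)) := inertial_sequence
  (phi := fun n => `|x n - z| ^+ 2) (d := fun n => `|dx n| ^+ 2)
  (e := fun n => `|xp n| ^+ 2)
  (fun n => sqr_ge0 `|x n - z|) (fun n => sqr_ge0 `|dx n|)
  (fun n => sqr_ge0 `|xp n|) mu0 sig2 al1 a_bnd a_mono (step z Az).
have [[M xM] [S1 sumd] [S2 sume] [d0 e0] _] := conv _ Az0.
have dx0 : dx @ \oo --> 0 by exact: sqr_norm_cvg0 d0.
have xp0 : xp @ \oo --> 0 by exact: sqr_norm_cvg0 e0.
(* From |x_n - z0|^2 <= M and t <= t^2 + 1. *)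
pose K := M + 1 + `|z0|.
have xK n : `|x n| <= K.
  rewrite -[x n](subrK z0); apply: le_trans (ler_normD _ _) _; rewrite lerD2r.
  have := xM n; have := sqr_ge0 (`|x n - z0| - 1).
  by have := sqr_ge0 `|x n - z0|; rewrite sqrrB; lra.
have K0 : 0 <= K by exact: le_trans (xK 0).
have dist_cvg z : A z (- B z) -> cvg (`|x n - z| ^+ 2 @[n --> \oo]).
  move=> /conv[_ _ _ _]; apply.
  (* A difference of squares: the difference of the norms is at most |dx n|, and their sum is
     bounded. *)
  apply: (cvg_dist_le (g := fun n => `|dx n - 0| * (2 * (K + `|z|)))).
    apply: nearW => n; rewrite !subr0 subr_sqr normrM.
    have tri (m : nat) : `|x m - z| <= K + `|z|.
      by apply: le_trans (ler_normB _ _) _; rewrite lerD2r.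
    apply: ler_pM => //.
      by apply: le_trans (ler_dist_dist _ _) _; rewrite opprB addrA subrK.
    by rewrite ger0_norm ?addr_ge0//; have := tri n; have := tri n.+1; lra.
  rewrite -(mul0r (2 * (K + `|z|))); apply: cvgM; last exact: cvg_cst.
  exact: (cvg_dist0 dx0).
(* u_n belongs to (A + B) p_(n+1) and tends to 0; the lower bound lambda keeps the inverse step
   sizes bounded. *)
pose u n := r n + B (p n.+1).
have u0 : u @ \oo --> 0.
  apply: (cvg_dist_le (g := fun n =>
    lambda^-1 * (`|xp n - 0| + alpha1 * `|dx n - 0|) + beta * `|xp n - 0|)).
    apply: nearW => n; rewrite !subr0.
    have -> : u n = (lambda_ n.+1)^-1 *: (xp n + alpha1_ n.+1 *: dx n) -
        (B (x n.+1) - B (p n.+1)).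
      apply: ip_inj => h; rewrite !ipE; field.
      by rewrite gt_eqF.
    apply: le_trans (ler_normB _ _) _; apply: lerD; last exact: Blip.
    rewrite normrZ gtr0_norm ?invr_gt0//; apply: ler_pM => //.
    - by rewrite invr_ge0 ltW.
    - by rewrite lef_pV2 ?posrE.
    - apply: le_trans (ler_normD _ _) _; rewrite lerD2l normrZ.
      have /andP[h1 h2] := a1b n.+1 isT.
      by rewrite ger0_norm// ler_wpM2r.
  have xp0' : `|xp n - 0| @[n --> \oo] --> 0 by exact: cvg_dist0 xp0.
  have dx0' : `|dx n - 0| @[n --> \oo] --> 0 by exact: cvg_dist0 dx0.
  rewrite -[X in _ --> X](_ : lambda^-1 * (0 + alpha1 * 0) + beta * 0 = 0); last first.
    by rewrite !mulr0 !addr0 mulr0.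
  apply: cvgD; last by apply: cvgM => //; exact: cvg_cst.
  apply: cvgM; first exact: cvg_cst.
  by apply: cvgD => //; apply: cvgM => //; exact: cvg_cst.
have [L pL] : exists L, forall n, `|p n.+1| <= L.
  exists (K + S2 + 1) => n; rewrite (_ : p n.+1 = x n.+1 - xp n); last first.
    by rewrite /xp opprB addrC subrK.
  apply: le_trans (ler_normB _ _) _; rewrite -addrA; apply: lerD => //.
  have := sume n.+1; rewrite big_nat_recr//=.
  have : 0 <= \sum_(0 <= i < n) `|xp i| ^+ 2.
    by apply: sumr_ge0 => i _; exact: sqr_ge0.
  have := sqr_ge0 (`|xp n| - 1); have := sqr_ge0 `|xp n|; rewrite sqrrB; lra.
have pu y : ip (p n.+1 - y) (u n) @[n --> \oo] --> 0.
  apply: (cvg_dist_le (g := fun n => (L + `|y|) * `|u n - 0|)).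
    apply: nearW => n; rewrite !subr0; apply: le_trans (normr_ip_le _ _) _.
    rewrite ler_wpM2r//; apply: le_trans (ler_normB _ _) _.
    by rewrite lerD2r.
  rewrite -(mulr0 (L + `|y|)); apply: cvgM; first exact: cvg_cst.
  exact: (cvg_dist0 u0).
have px0 y : ip (p n.+1 - x n) y @[n --> \oo] --> 0.
  rewrite (_ : (fun n => _) = fun n => ip (dx n - xp n) y); last first.
    by apply/funext => n; congr ip; apply: ip_inj => h; rewrite !ipE; ring.
  rewrite -(ip0l y) -[0 in X in _ --> X]subr0.
  by apply: cvg_ip; [exact: cvgB|exact: cvg_cst].
have [|U w UU ooU xw|xbar Axbar xweak] :=
  @opial R H x [set z | A z (- B z)] K xK.
- by move=> z; exact: dist_cvg.
- have PU : ProperFilter U by exact: ultra_proper.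
  (* Monotonicity of A + B gives <p_(n+1) - y, v + B y> <= <p_(n+1) - y, u_n>; pass to the limit
     along U. *)
  apply: (zer_sum_mem Amax b0 Blip) => y v Ay.
  apply: (cvg_ler (F := U) (f := fun n => ip (p n.+1 - y) (v + B y))
    (g := fun n => ip (p n.+1 - y) (u n))).
  + move=> n; rewrite -subr_ge0 -ipNr -ipDr.
    have h1 : 0 <= ip (p n.+1 - y) (r n - v) := Amon _ _ _ _ (Ar n) Ay.
    have h2 : 0 <= ip (p n.+1 - y) (B (p n.+1) - B y) by exact: Bmon.
    by rewrite /u; move: h1 h2; rewrite !ipE; lra.
  + rewrite (_ : (fun n => _) = fun n => ip (p n.+1 - x n) (v + B y) +
        ip (x n) (v + B y) - ip y (v + B y)); last first.
      by apply/funext => n; rewrite !ipE; ring.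
    rewrite ipDl ipNl -[ip w _]add0r.
    apply: cvgB; last exact: cvg_cst.
    by apply: cvgD => //; apply: cvg_trans (px0 _); exact: cvg_app.
  + by apply: cvg_trans (pu _); exact: cvg_app.
have pweak y : ip (p n.+1) y @[n --> \oo] --> ip xbar y.
  rewrite (_ : (fun n => _) = fun n => ip (p n.+1 - x n) y + ip (x n) y); last first.
    by apply/funext => n; rewrite !ipE subrK.
  by rewrite -[ip xbar y]add0r; apply: cvgD.
exists xbar; first exact/zer_sumP.
split.
- split; first exact: nneseries_lty_bounded sumd.
  apply: (@nneseries_lty_bounded _ _ _ S2) => [n|[|n]]; first exact: sqr_ge0.
    by have := sume 0; rewrite !big_geq.
  by rewrite big_add1.
- split=> y; first exact: xweak.
  by rewrite -(cvg_shiftS (fun n => inner (p n) y)); exact: pweak.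
(* Strong convergence of p_(n+1) suffices, since x_(n+1) - p_(n+1) tends to 0. *)
move=> hyp; suff pcvg : p n.+1 @[n --> \oo] --> xbar.
  have ppcvg : p @ \oo --> xbar by rewrite -(cvg_shiftS p).
  split=> //; rewrite -(cvg_shiftS x).
  rewrite (_ : (fun n => _) = fun n => p n.+1 + xp n); last first.
    by apply/funext => n; rewrite /xp addrC subrK.
  by rewrite -[xbar]addr0; exact: cvgD.
case: hyp => [demi|].
  apply: (demi.2 (fun n => p n.+1) u 0) => //; last exact/zer_sumP.
  by move=> n; exists (r n); [exact: Ar|exists (B (p n.+1))].
apply: uniformly_monotone_cvg Amon Bmon Axbar Ar _.
rewrite (_ : (fun n => _) = fun n => ip (p n.+1 - xbar) (u n)); first exact: pu.
by apply/funext => n; rewrite /u !ipE; ring.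
Qed.
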